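(* Let $R$ be a finite Frobenius ring and let $C\leq{}_RR^n$ be a modular (left) linear code generated by $\mathbf{G}=(\mathbf{g}_1|\dots|\mathbf{g}_n)\in R^{k\times n}$, i.e. $C=\{\mathbf{x}\mathbf{G};\ \mathbf{x}\in R^k\}$. Let $D\leq R^k_R$ be the right column space of $\mathbf{G}$, i.e. $D=\mathbf{g}_1R+\dots+\mathbf{g}_nR$. Suppose that $C$ has no all-zero coordinate and satisfies $C_0=\{\mathbf{c}\in C;\ \mathrm{w}_{\mathrm{hom}}(\mathbf{c})=0\}=\{\mathbf{0}\}$. Then the following are equivalent: (i) $C$ is a homogeneous two-weight code; (ii) $\Omega=\mathbf{g}_1R^\times\cup\dots\cup\mathbf{g}_nR^\times$ is a partial difference set in $(D,+)$ and $\Omega\cup\{\mathbf{0}\}$ is not a submodule of $R^k_R$.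
   Context: Rings are associative with $1$; $R^\times$ is the group of units; $n,k$ are positive integers. A finite ring $R$ is a Frobenius ring if there is a character $\chi\in\mathrm{Hom}_{\mathbb{Z}}(R,\mathbb{C}^\times)$ of $(R,+)$ whose kernel contains no nonzero left (or right) ideal of $R$. The (normalized) homogeneous weight $\mathrm{w}_{\mathrm{hom}}\colon R\to\mathbb{C}$ is $\mathrm{w}_{\mathrm{hom}}(x)=1-\frac{1}{|R^\times|}\sum_{u\in R^\times}\chi(ux)$ (independent of the choice of such $\chi$; its values are real and nonnegative). It is extended to $R^n$ by $\mathrm{w}_{\mathrm{hom}}(\mathbf{x})=\sum_{j=1}^n\mathrm{w}_{\mathrm{hom}}(x_j)$. A homogeneous two-weight code is a linear code on which $\mathrm{w}_{\mathrm{hom}}$ takes exactly two nonzero values. ''No all-zero coordinate'' means that for each $j$ some codeword has nonzero $j$-th entry. Modular codes: for $C=\{\mathbf{x}\mathbf{G};\mathbf{x}\in R^k\}$ without all-zero coordinate, $\mathbf{G}=(\mathbf{g}_1|\dots|\mathbf{g}_n)\in R^{k\times n}$, and a nonzero cyclic right submodule $\mathbf{g}R$ of $R^k_R$ (a ''point'') let $\alpha_C(\mathbf{g}R)=|\{j;\ \mathbf{g}_jR=\mathbf{g}R\}|$. The code $C$ is modular if there exists $r\in\mathbb{Q}$ such that for every point $\mathbf{g}R$ either $\alpha_C(\mathbf{g}R)=0$ or $\alpha_C(\mathbf{g}R)=r\,|\mathbf{g}R^\times|$. (This does not depend on the choice of $k$ and $\mathbf{G}$.) Partial difference set here means regular partial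 difference set: a subset $\Omega$ of a finite additive abelian group $G$ with $0\notin\Omega$, $-\Omega=\Omega$, for which there are integers $\lambda,\mu$ such that the multiset $\Omega-\Omega$ of differences represents each element of $\Omega$ exactly $\lambda$ times and each element of $G\setminus(\Omega\cup\{0\})$ exactly $\mu$ times. *)

(* Defs.v *)
From HB Require Import structures.
From mathcomp Require Import all_boot all_order all_algebra.

Set Implicit Arguments.
Unset Strict Implicit.
Unset Printing Implicit Defensive.

Import GRing.Theory Num.Theory.

Local Open Scope ring_scope.

(* Finite rings are taken as finUnitRingType. This leaves out only the trivial
   ring, over which a code of positive length always has an all-zero coordinate.
   The complex numbers are an arbitrary numClosedFieldType K, such as algC or
   T[i] for T : realType. *)

Definition units (R : finUnitRingType) : {set R} :=
  [set u : R | u \is a GRing.unit].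

Definition additive_character (K : numClosedFieldType) (R : finUnitRingType)
    (chi : R -> K) : Prop :=
  (forall x, chi x != 0) /\ (forall x y, chi (x + y) = chi x * chi y).

(* Left ideals are the submodules of R^o. R is a Frobenius ring iff it has a
   generating character; for finite R, using right ideals instead gives the
   same characters. *)
Definition generating_character (K : numClosedFieldType) (R : finUnitRingType)
    (chi : R -> K) : Prop :=
  additive_character chi /\
  (forall I : {pred R^o}, GRing.submod_closed I ->
     {in I, forall x, chi x = 1} -> {in I, forall x, x = 0}).

(* The result does not depend on the generating character chi. *)
Definition hom_weight (K : numClosedFieldType) (R : finUnitRingType)
    (chi : R -> K) (x : R) : K :=
  1 - #|units R|%:R^-1 * \sum_(u in units R) chi (u * x).

Definition hom_weight_vec (K : numClosedFieldType) (R : finUnitRingType)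
    (chi : R -> K) (n : nat) (x : 'rV[R]_n) : K :=
  \sum_(j < n) hom_weight chi (x 0 j).

Definition two_weight_code (K : numClosedFieldType) (R : finUnitRingType)
    (chi : R -> K) (n : nat) (C : {set 'rV[R]_n}) : Prop :=
  exists w1 w2 : K, [/\ w1 != 0, w2 != 0, w1 != w2 &
    forall w : K, w != 0 ->
      (exists2 c, c \in C & hom_weight_vec chi c = w) <-> (w = w1 \/ w = w2)].

Definition no_zero_coordinate (R : finUnitRingType) (n : nat)
    (C : {set 'rV[R]_n}) : Prop :=
  forall j : 'I_n, exists2 c, c \in C & c 0 j != 0.

Definition code_of (R : finUnitRingType) (k n : nat) (G : 'M[R]_(k, n)) :
    {set 'rV[R]_n} :=
  [set x *m G | x : 'rV[R]_k].

Definition column_space (R : finUnitRingType) (k n : nat) (G : 'M[R]_(k, n)) :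
    {set 'cV[R]_k} :=
  [set G *m y | y : 'cV[R]_n].

(* Multiplying a column on the right by the 1 x 1 matrix r%:M multiplies each
   of its entries by r on the right. *)
Definition cyclic_submodule (R : finUnitRingType) (k : nat) (g : 'cV[R]_k) :
    {set 'cV[R]_k} :=
  [set g *m r%:M | r : R].

Definition unit_orbit (R : finUnitRingType) (k : nat) (g : 'cV[R]_k) :
    {set 'cV[R]_k} :=
  [set g *m u%:M | u in units R].

Definition right_submodule (R : finUnitRingType) (k : nat)
    (S : {set 'cV[R]_k}) : Prop :=
  [/\ 0 \in S, {in S &, forall g h, g + h \in S} &
      forall r : R, {in S, forall g, g *m r%:M \in S}].

Definition point_mult (R : finUnitRingType) (k n : nat) (G : 'M[R]_(k, n))
    (g : 'cV[R]_k) : nat :=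
  #|[set j : 'I_n | cyclic_submodule (col j G) == cyclic_submodule g]|.

(* In a finite ring gR = hR implies gR^x = hR^x, so letting g range over the
   generators of the points is the same as quantifying over the points. *)
Definition modular (R : finUnitRingType) (k n : nat) (G : 'M[R]_(k, n)) :
    Prop :=
  exists r : rat, forall g : 'cV[R]_k, g != 0 ->
    point_mult G g = 0%N \/
    (point_mult G g)%:R = r * #|unit_orbit g|%:R.

Definition column_orbits (R : finUnitRingType) (k n : nat)
    (G : 'M[R]_(k, n)) : {set 'cV[R]_k} :=
  \bigcup_(j < n) unit_orbit (col j G).

Definition difference_count (V : finZmodType) (Omega : {set V}) (x : V) : nat :=
  #|[set p : V * V | [&& p.1 \in Omega, p.2 \in Omega & p.1 - p.2 == x]]|.

(* The set D is meant to be a subgroup of V. *)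
Definition partial_difference_set (V : finZmodType) (D Omega : {set V}) :
    Prop :=
  [/\ Omega \subset D, 0 \notin Omega, [set - x | x in Omega] = Omega &
      exists lambda mu : int,
        {in Omega, forall x, (difference_count Omega x)%:Z = lambda} /\
        {in D :\: (0 |: Omega),
          forall x, (difference_count Omega x)%:Z = mu}].

(* Main.v *)
Require Import Defs.
From HB Require Import structures.
From mathcomp Require Import all_boot all_order all_algebra.
From mathcomp Require Import ring.

Set Implicit Arguments.
Unset Strict Implicit.
Unset Printing Implicit Defensive.

Import GRing.Theory Num.Theory.

Local Open Scope ring_scope.

(* For a row x write S(x) for the sum of chi(x * d) over d in Omega. Modularity
   and the symmetry of the homogeneous weight give w_hom(xG) = r (|Omega| - S(x))
   with r nonzero, so the weights of the nonzero codewords are governed by the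
   nontrivial character values of Omega. By Fourier inversion on D, Omega = -Omega
   is a partial difference set iff S(x)^2 = a S(x) + b for all x with xG <> 0,
   and S is constant there iff Omega together with 0 is all of D.

   Two facts about finite rings enter. If gR = hR then h = gu for a unit u: each
   right ideal Y contains as many solutions x of gx = g as of gx = h, hence by
   induction on Y as many with xR = Y, and for Y = R the first equation has the
   solution 1. In a Frobenius ring every character x |-> chi(xa) has the form
   x |-> chi(bx), where b is a unit if a is, so the sums of chi(ux) and of
   chi(xu) over all units u agree. *)

(** * One-sided units in a finite ring *)

Lemma right_invertible_unit (R : finUnitRingType) (b c : R) :
  b * c = 1 -> b \is a GRing.unit.
Proof.
move=> bc1; have inj_c : injective ( *%R c).
  by move=> x y /= /(congr1 ( *%R b)); rewrite !mulrA bc1 !mul1r.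
(* An injective self-map of a finite set is onto, so [c] has a right inverse [d], and associativity
   forces [d = b]. *)
have /codomP[d cd1] : 1 \in codom ( *%R c) by rewrite (inj_card_onto inj_c).
have bd : b = d by rewrite -[b]mulr1 cd1 mulrA bc1 mul1r.
by apply/unitrP; exists c; rewrite bc1 bd -cd1.
Qed.

Lemma left_regular_unit (R : finUnitRingType) (b : R) :
  (forall x, b * x = 0 -> x = 0) -> b \is a GRing.unit.
Proof.
move=> reg_b; have inj_b : injective ( *%R b).
  move=> x y /eqP; rewrite -subr_eq0 -mulrBr => /eqP/reg_b/eqP.
  by rewrite subr_eq0 => /eqP.
have /codomP[c bc1] : 1 \in codom ( *%R b) by rewrite (inj_card_onto inj_b).
exact: (right_invertible_unit (esym bc1)).
Qed.

(** * Cyclic right submodules and orbits of the unit group *)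

Section CyclicSubmodules.

Variables (R : finUnitRingType) (k : nat).
Implicit Types (g h : 'cV[R]_k) (r s u : R).

Lemma mulmx_scalarA g r s : g *m r%:M *m s%:M = g *m (r * s)%:M.
Proof. by rewrite -mulmxA -scalar_mxM. Qed.

Lemma mulmx_scalarE g r i : (g *m r%:M) i 0 = g i 0 * r.
Proof. by rewrite mxE big_ord1 mxE eqxx mulr1n. Qed.

Lemma mem_cyclic g h : reflect (exists r, h = g *m r%:M) (h \in cyclic_submodule g).
Proof.
by apply: (iffP imsetP) => [[r _ ->]|[r ->]]; exists r.
Qed.

Lemma cyclic_self g : g \in cyclic_submodule g.
Proof. by apply/mem_cyclic; exists 1; rewrite mulmx1. Qed.

Lemma unit_orbitP g h :
  reflect (exists2 u, u \is a GRing.unit & h = g *m u%:M) (h \in unit_orbit g).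
Proof.
by apply: (iffP imsetP) => [[u]|[u]]; rewrite ?inE => Uu ->; exists u; rewrite ?inE.
Qed.

Lemma unit_orbit_self g : g \in unit_orbit g.
Proof. by apply/unit_orbitP; exists 1; rewrite ?unitr1 ?mulmx1. Qed.

Lemma cyclic_unit_orbit g h :
  h \in unit_orbit g -> cyclic_submodule h = cyclic_submodule g.
Proof.
case/unit_orbitP=> u Uu ->; apply/setP=> x.
apply/mem_cyclic/mem_cyclic => -[r ->].
  by exists (u * r); rewrite mulmx_scalarA.
by exists (u^-1 * r); rewrite mulmx_scalarA mulVKr.
Qed.

Definition rprincipal (x : R) : {set R} := [set x * r | r : R].

Lemma rprincipal_self x : x \in rprincipal x.
Proof. by apply/imsetP; exists 1; rewrite ?mulr1. Qed.

Lemma rprincipal_sub x y : (rprincipal x \subset rprincipal y) = (x \in rprincipal y).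
Proof.
apply/subsetP/idP => [/(_ _ (rprincipal_self x)) //|].
case/imsetP=> r _ -> _ /imsetP[s _ ->].
by apply/imsetP; exists (r * s); rewrite ?mulrA.
Qed.

Definition quotients g h (Y : {set R}) : {set R} :=
  [set x in Y | g *m x%:M == h].

(** For [Y = R] these are the unit solutions of [g x = h], because [xR = R] makes [x] right
    invertible. *)
Definition principal_quotients g h (Y : {set R}) : {set R} :=
  [set x | (g *m x%:M == h) && (rprincipal x == Y)].

(** If [x0] is one solution in [yR] and [h' = h b], then each solution [x] yields the solution
    [x - x0 + x0 b] for [h'], because [g] kills [x - x0]. *)
Lemma leq_card_quotients g h h' y :
  cyclic_submodule h = cyclic_submodule h' ->
  (#|quotients g h (rprincipal y)| <= #|quotients g h' (rprincipal y)|)%N.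
Proof.
move=> hh'; have [->|[x0]] := set_0Vmem (quotients g h (rprincipal y)).
  by rewrite cards0.
rewrite inE => /andP[/imsetP[r0 _ x0E] /eqP gx0].
have /mem_cyclic[b h'E] : h' \in cyclic_submodule h by rewrite hh' cyclic_self.
have inj_f : injective (fun x => x - x0 + x0 * b).
  by move=> x x' /addIr/addIr.
rewrite -(card_imset _ inj_f); apply/subset_leq_card/subsetP=> _ /imsetP[x + ->].
rewrite !inE => /andP[/imsetP[r _ ->] /eqP gx]; apply/andP; split.
  by apply/imsetP; exists (r - r0 + r0 * b); rewrite // x0E mulrDr mulrBr mulrA.
by rewrite raddfD raddfB /= mulmxDr mulmxBr gx gx0 subrr add0r -mulmx_scalarA gx0 h'E.
Qed.

Lemma card_quotients_partition g h y :
  #|quotients g h (rprincipal y)| =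
  \sum_(Z : {set R} | Z \subset rprincipal y) #|principal_quotients g h Z|.
Proof.
rewrite -sum1_card (partition_big rprincipal (fun Z => Z \subset rprincipal y)) /=.
  apply: eq_bigr => Z ZY; rewrite -sum1_card; apply: eq_bigl => x.
  rewrite !inE; case: (rprincipal x =P Z) => [xZ|_]; rewrite ?andbF // !andbT.
  by rewrite -rprincipal_sub xZ ZY.
by move=> x; rewrite inE rprincipal_sub => /andP[].
Qed.

(** Induction on the size of [Y]: the totals over a principal [Y] agree, and so do the terms for
    smaller ideals, which leaves equality for [Y] itself. *)
Lemma card_principal_quotients g h h' (Y : {set R}) :
  cyclic_submodule h = cyclic_submodule h' ->
  #|principal_quotients g h Y| = #|principal_quotients g h' Y|.
Proof.
move=> hh'; have [m] := ubnP #|Y|; elim: m Y => // m IHm Y leYm.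
(* A set that is not a principal right ideal has no generators, so both counts are 0. *)
have [/existsP[y /eqP defY]|noY] := boolP [exists y, rprincipal y == Y]; last first.
  have empty f : principal_quotients g f Y = set0.
    apply/setP=> x; rewrite !inE; apply/negP=> /andP[_ xY].
    by case/existsP: noY; exists x.
  by rewrite !empty.
have : #|quotients g h (rprincipal y)| = #|quotients g h' (rprincipal y)|.
  by apply/eqP; rewrite eqn_leq !leq_card_quotients.
rewrite !card_quotients_partition (bigD1 (rprincipal y)) //=.
rewrite [in RHS](bigD1 (rprincipal y)) //=.
rewrite defY (eq_bigr (fun Z : {set R} => #|principal_quotients g h' Z|)) => [|Z].
  by move/addIn.
case/andP=> ZY neqZY; apply: IHm; rewrite ltnS in leYm.
by apply: leq_trans leYm; apply: proper_card; rewrite properEneq neqZY.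
Qed.

Lemma cyclic_eq_unit_orbit g h :
  cyclic_submodule g = cyclic_submodule h -> h \in unit_orbit g.
Proof.
move=> gh; have : (0 < #|principal_quotients g h (rprincipal 1%R)|)%N.
  rewrite (card_principal_quotients g _ (esym gh)); apply/card_gt0P; exists 1.
  by rewrite inE mulmx1 !eqxx.
case/card_gt0P=> x; rewrite inE => /andP[/eqP gx /eqP xR].
have /imsetP[y _ xy] : 1 \in rprincipal x by rewrite xR rprincipal_self.
by apply/unit_orbitP; exists x; rewrite ?gx // (right_invertible_unit (esym xy)).
Qed.

Lemma unit_orbit_cyclic g h :
  (h \in unit_orbit g) = (cyclic_submodule g == cyclic_submodule h).
Proof.
by apply/idP/eqP => [/cyclic_unit_orbit|/cyclic_eq_unit_orbit].
Qed.

Lemma unit_orbit_eq g h : h \in unit_orbit g -> unit_orbit h = unit_orbit g.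
Proof.
by move=> /cyclic_unit_orbit hg; apply/setP=> d; rewrite !unit_orbit_cyclic hg.
Qed.

Definition unit_fiber g h : {set R} := [set u in units R | g *m u%:M == h].

(** Orbit-stabilizer: the fiber over [g v] is the stabilizer of [g] multiplied by [v], so all fibers
    over the orbit have equal size. *)
Lemma card_unit_fiber g h :
  h \in unit_orbit g -> (#|unit_orbit g| * #|unit_fiber g h|)%N = #|units R|.
Proof.
have fiberE f : f \in unit_orbit g -> #|unit_fiber g f| = #|unit_fiber g g|.
  case/unit_orbitP=> v Uv ->.
  rewrite -(card_imset (unit_fiber g g) (can_inj (mulrK Uv))).
  apply: eq_card => u; rewrite !inE; apply/andP/imsetP => [[Uu /eqP gu]|[w]].
    exists (u * v^-1); last by rewrite mulrVK.
    rewrite !inE unitrMl ?unitrV // Uu -mulmx_scalarA gu mulmx_scalarA mulrV //.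
    by rewrite mulmx1 /=.
  rewrite !inE => /andP[Uw /eqP gw] ->; split; first by rewrite unitrMl.
  by rewrite -mulmx_scalarA gw.
move=> /fiberE ->; rewrite -[RHS]sum1_card -sum_nat_const.
rewrite [RHS](partition_big_imset (fun u => g *m u%:M)) /=.
apply: eq_bigr => f /fiberE <-; rewrite -sum1_card.
by apply: eq_bigl => u; rewrite !inE.
Qed.

End CyclicSubmodules.

(** * Sums of additive characters over finite groups *)

Lemma sum_nontrivial_character (K : fieldType) (V : finZmodType) (A : {set V})
    (f : V -> K) (a : V) :
  {in A &, forall x y, x - y \in A} -> {morph f : x y / x + y >-> x * y} ->
  a \in A -> f a != 1 -> \sum_(x in A) f x = 0.
Proof.
move=> subA fD Aa fa1; apply/eqP.
have A0 : 0 \in A by rewrite -(subrr a) subA.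
have addA x y : x \in A -> y \in A -> x + y \in A.
  by move=> Ax Ay; rewrite -[y]opprK subA // -sub0r subA.
(* Translation by [a] permutes [A] and multiplies the sum by [f a], which differs from 1. *)
have shift : \sum_(x in A) f x = f a * \sum_(x in A) f x.
  rewrite [LHS](reindex_inj (addrI a)) big_distrr /=.
  apply: eq_big => [x|x _]; last exact: fD.
  by apply/idP/idP => [/(subA _ _)/(_ Aa)|]; rewrite ?[a + x]addrC ?addrK // => /addA ->.
by move/eqP: shift; rewrite -subr_eq0 -{1}[\sum_(x in A) _]mul1r -mulrBl mulf_eq0
  subr_eq0 eq_sym (negPf fa1).
Qed.

Lemma sum_nontrivial_character_all (K : fieldType) (V : finZmodType) (f : V -> K) (a : V) :
  {morph f : x y / x + y >-> x * y} -> f a != 1 -> \sum_x f x = 0.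
Proof.
move=> fD fa1; transitivity (\sum_(x in [set: V]) f x).
  by apply: eq_bigl => x; rewrite inE.
by apply: sum_nontrivial_character fD _ fa1 => [x y _ _|]; rewrite inE.
Qed.

Lemma sum_indicator (K : nzRingType) (T : finType) (A : {set T}) (F : T -> K) :
  \sum_x (x \in A)%:R * F x = \sum_(x in A) F x.
Proof.
by rewrite [RHS]big_mkcond; apply: eq_bigr => x _; case: ifP; rewrite ?mul1r ?mul0r.
Qed.

(** * Left and right nondegeneracy of a generating character *)

Section GeneratingCharacter.

Variables (K : numClosedFieldType) (R : finUnitRingType) (chi : R -> K).
Hypothesis frobR : generating_character chi.

Lemma chiD : {morph chi : x y / x + y >-> x * y}.
Proof. by case: frobR => -[]. Qed.

Lemma chi_neq0 x : chi x != 0.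
Proof. by case: frobR => -[]. Qed.

Lemma chi0 : chi 0 = 1.
Proof.
by apply: (mulfI (chi_neq0 0)); rewrite -chiD addr0 mulr1.
Qed.

(** The left ideal [Ra] lies in the kernel of [chi]. *)
Lemma chi_left_nondegenerate a : (forall x, chi (x * a) = 1) -> a = 0.
Proof.
move=> chi_a; case: frobR => _ /(_ [pred y : R^o | [exists x : R, y == x * a]]).
apply.
- split=> [|c y z]; first by rewrite !inE; apply/existsP; exists 0; rewrite mul0r.
  rewrite !inE => /existsP[u /eqP ->] /existsP[v /eqP ->]; apply/existsP.
  by exists (c * u + v); rewrite mulrDl -mulrA; apply: eqxx.
- by move=> y; rewrite inE => /existsP[x /eqP ->].
- by rewrite inE; apply/existsP; exists 1; rewrite mul1r.
Qed.

Lemma sum_chi_left a : \sum_x chi (x * a) = #|R|%:R * (a == 0)%:R.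
Proof.
have [->|a_neq0] := eqVneq a 0.
  by rewrite mulr1 -sumr_const; apply: eq_bigr => x _; rewrite mulr0 chi0.
have /existsP[x chi_xa] : [exists x, chi (x * a) != 1].
  apply: contraR a_neq0 => /existsPn chi_a; apply/eqP/chi_left_nondegenerate => x.
  exact/eqP/negPn/chi_a.
rewrite mulr0; apply: (@sum_nontrivial_character_all K R (fun x => chi (x * a)) x) => // y z.
by rewrite mulrDl chiD.
Qed.

Lemma card_ring_neq0 : #|R|%:R != 0 :> K.
Proof. by rewrite pnatr_eq0 -lt0n; apply/card_gt0P; exists 0. Qed.

(* Evaluating the sum of chi(a * r) over all a and r in both orders shows that
   only a = 0 annihilates chi on the right. *)
Lemma chi_right_nondegenerate a : (forall r, chi (a * r) = 1) -> a = 0.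
Proof.
pose A := [set b | [forall r, chi (b * r) == 1]].
have rowE b : \sum_r chi (b * r) = #|R|%:R * (b \in A)%:R.
  rewrite inE; case: (boolP [forall r, _]) => [/forallP chi_b|/forallPn[r chi_br]].
    by rewrite mulr1 -sumr_const; apply: eq_bigr => r _; exact/eqP/chi_b.
  rewrite mulr0; apply: (@sum_nontrivial_character_all K R (fun r => chi (b * r)) r) => // y z.
  by rewrite mulrDr chiD.
have : \sum_b \sum_r chi (b * r) = \sum_r \sum_b chi (b * r) by rewrite exchange_big.
under eq_bigr do rewrite rowE; rewrite -big_distrr /=.
under [in RHS]eq_bigr do rewrite sum_chi_left; rewrite -big_distrr /=.
move/(mulfI card_ring_neq0); rewrite [RHS](bigD1 0) //= [X in _ + X]big1 => [|r]; last first.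
  by move/negPf->.
under eq_bigr do rewrite -[_%:R]mulr1; rewrite sum_indicator eqxx addr0.
rewrite sumr_const => /eqP; rewrite eqr_nat.
case/cards1P=> b AE chi_a.
have : a \in A by rewrite inE; apply/forallP => r; rewrite chi_a.
have : 0 \in A by rewrite inE; apply/forallP => r; rewrite mul0r chi0.
by rewrite AE !inE => /eqP -> /eqP ->.
Qed.

(** Summing [chi (x * a - b * x)] over [b] first leaves only [x = 0], so the double sum is nonzero.
    If no [b] worked, every sum over [x] would run over a nontrivial character and vanish. *)
Lemma chi_twist a : exists b, forall x, chi (x * a) = chi (b * x).
Proof.
have : \sum_b \sum_x chi (x * a - b * x) != 0.
  rewrite exchange_big (bigD1 0) //= [X in _ + X]big1 => [|x x_neq0].
    rewrite addr0 (eq_bigr (fun=> 1)) => [|b _]; last by rewrite mul0r mulr0 subrr chi0.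
    by rewrite sumr_const card_ring_neq0.
  rewrite (reindex_inj oppr_inj) /=.
  under eq_bigr do rewrite mulNr opprK chiD.
  by rewrite -big_distrr /= sum_chi_left (negPf x_neq0) !mulr0.
case/boolP: [exists b, [forall x, chi (x * a) == chi (b * x)]].
  by case/existsP=> b /forallP chib _; exists b => x; apply/eqP.
move/existsPn=> nob; case/eqP; apply: big1 => b _.
have /forallPn[x chi_x] := nob b.
apply: (@sum_nontrivial_character_all K R (fun x => chi (x * a - b * x)) x) => [y z|].
  by rewrite mulrDl mulrDr opprD addrACA chiD.
apply: contra chi_x => /eqP chi1.
by rewrite -[x * a](subrK (b * x)) chiD chi1 mul1r.
Qed.

(** The map sending [a] to the [b] of [chi_twist] is injective and preserves units, so it permutes
    the units and reindexes the sum. *)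
Lemma sum_units_chiC x : \sum_(u in units R) chi (u * x) = \sum_(u in units R) chi (x * u).
Proof.
have /fin_all_exists[phi chi_phi] := chi_twist.
have inj_phi : injective phi.
  move=> a b eq_ab; apply/eqP; rewrite -subr_eq0; apply/eqP/chi_left_nondegenerate => y.
  have := chi_phi a y; rewrite eq_ab -chi_phi => eq_chi.
  by apply: (mulIf (chi_neq0 (y * b))); rewrite -chiD mulrBr subrK mul1r.
have unit_phi a : a \in units R -> phi a \in units R.
  rewrite !inE => Ua; apply: left_regular_unit => y phi_y.
  (* Writing [r] as [(r / a) * a] lets [a] cross to the left as [phi a], which kills [y]; hence
     [chi] is trivial on [yR]. *)
  apply: chi_right_nondegenerate => r.
  by rewrite -(mulrVK Ua r) mulrA chi_phi !mulrA phi_y !mul0r chi0.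
have phiE : phi @: units R = units R.
  apply/eqP; rewrite eqEcard card_imset // leqnn andbT.
  by apply/subsetP=> _ /imsetP[a Ua ->]; apply: unit_phi.
rewrite -{1}phiE big_imset /=; last by move=> a b _ _; apply: inj_phi.
by apply: eq_bigr => u _; rewrite -chi_phi.
Qed.

End GeneratingCharacter.

(** * Fourier analysis on columns over [R] *)

Section Fourier.

Variables (K : numClosedFieldType) (R : finUnitRingType) (chi : R -> K).
Hypothesis frobR : generating_character chi.
Variable k : nat.
Implicit Types (x : 'rV[R]_k) (d e : 'cV[R]_k) (f : 'cV[R]_k -> K).

(** Each row acts in this way as a character of the additive group of columns, so sums over rows
    serve for Fourier inversion. *)
Definition pairing x d : K := chi ((x *m d) 0 0).

Lemma pairingDr x : {morph pairing x : d e / d + e >-> d * e}.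
Proof. by move=> d e; rewrite /pairing mulmxDr mxE chiD. Qed.

Lemma pairingDl d : {morph pairing^~ d : x y / x + y >-> x * y}.
Proof. by move=> x y; rewrite /pairing mulmxDl mxE chiD. Qed.

Lemma pairing0r x : pairing x 0 = 1.
Proof. by rewrite /pairing mulmx0 mxE chi0. Qed.

(** For a nonzero entry [d i 0], left nondegeneracy gives [a] with [chi (a * d i 0) != 1]; the row
    with [a] at place [i] shows nontriviality. *)
Lemma sum_pairing_row d : \sum_x pairing x d = #|{: 'rV[R]_k}|%:R * (d == 0)%:R.
Proof.
have [->|d_neq0] := eqVneq d 0.
  by rewrite mulr1 -sumr_const; apply: eq_bigr => x _; rewrite pairing0r.
have /existsP[i di_neq0] : [exists i, d i 0 != 0].
  apply: contraR d_neq0 => /existsPn d0; apply/eqP/matrixP => i j.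
  by rewrite ord1 mxE; apply/eqP/negPn/d0.
have /existsP[a chi_ad] : [exists a, chi (a * d i 0) != 1].
  apply: contraR di_neq0 => /existsPn chi_d.
  apply/eqP/(chi_left_nondegenerate frobR) => a; exact/eqP/negPn/chi_d.
rewrite mulr0.
apply: (@sum_nontrivial_character_all _ _ (pairing^~ d) (a *: delta_mx 0 i)).
  exact: pairingDl.
by rewrite /pairing -scalemxAl -rowE !mxE.
Qed.

Lemma card_rows_neq0 : #|{: 'rV[R]_k}|%:R != 0 :> K.
Proof. by rewrite pnatr_eq0 -lt0n; apply/card_gt0P; exists 0. Qed.

Lemma fourier_inversion f d :
  \sum_x (\sum_e f e * pairing x e) * pairing x (- d) = #|{: 'rV[R]_k}|%:R * f d.
Proof.
under eq_bigr do rewrite big_distrl /=.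
rewrite exchange_big (bigD1 d) //= [X in _ + X]big1 ?addr0 => [|e ed].
  under eq_bigr do rewrite -mulrA -pairingDr subrr.
  by rewrite -big_distrr /= sum_pairing_row eqxx mulr1 mulrC.
under eq_bigr do rewrite -mulrA -pairingDr.
by rewrite -big_distrr /= sum_pairing_row subr_eq0 (negPf ed) !mulr0.
Qed.

Variables (n : nat) (G : 'M[R]_(k, n)).

Lemma column_spaceP d : reflect (exists y, d = G *m y) (d \in column_space G).
Proof. by apply: (iffP imsetP) => [[y _ ->]|[y ->]]; exists y. Qed.

Lemma column_spaceB : {in column_space G &, forall d e, d - e \in column_space G}.
Proof.
move=> _ _ /column_spaceP[y ->] /column_spaceP[z ->].
by apply/column_spaceP; exists (y - z); rewrite mulmxBr.
Qed.

Lemma column_space_col j (r : R) : col j G *m r%:M \in column_space G.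
Proof.
by apply/column_spaceP; exists (delta_mx j 0 *m r%:M); rewrite mulmxA colE.
Qed.

Lemma pairing_annihilator x d : x *m G = 0 -> d \in column_space G -> pairing x d = 1.
Proof.
by move=> xG0 /column_spaceP[y ->]; rewrite /pairing mulmxA xG0 mul0mx mxE chi0.
Qed.

Lemma mulmx_colE x j : (x *m col j G) 0 0 = (x *m G) 0 j.
Proof. by rewrite colE mulmxA -colE mxE. Qed.

(** Right nondegeneracy enters here: a nonzero entry of [x *m G] gives a right multiple of a column
    of [G] on which [x] is nontrivial. *)
Lemma sum_pairing_column_space x :
  x *m G != 0 -> \sum_(d in column_space G) pairing x d = 0.
Proof.
move=> xG_neq0.
have /existsP[j xGj_neq0] : [exists j, (x *m G) 0 j != 0].
  apply: contraR xG_neq0 => /existsPn xG0; apply/eqP/matrixP => i j.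
  by rewrite ord1 [RHS]mxE; apply/eqP/negPn/xG0.
have /existsP[a chi_xGa] : [exists a, chi ((x *m G) 0 j * a) != 1].
  apply: contraR xGj_neq0 => /existsPn chi_xG.
  apply/eqP/(chi_right_nondegenerate frobR) => a; exact/eqP/negPn/chi_xG.
apply: (sum_nontrivial_character column_spaceB (pairingDr x) (column_space_col j a)).
by rewrite /pairing mulmxA mulmx_scalarE mulmx_colE.
Qed.

Local Notation Omega := (column_orbits G).

Lemma column_orbitsP d :
  reflect (exists j, d \in unit_orbit (col j G)) (d \in Omega).
Proof. by apply: (iffP bigcupP) => [[j _ dj]|[j dj]]; exists j. Qed.

(** This is [S(x)], the Fourier transform of the indicator function of [Omega]. *)
Definition orbit_sum x : K := \sum_(d in Omega) pairing x d.

Lemma orbit_sumE x : orbit_sum x = \sum_d (d \in Omega)%:R * pairing x d.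
Proof. by rewrite sum_indicator. Qed.

Lemma fourier_orbit_sum d :
  \sum_x orbit_sum x * pairing x (- d) = #|{: 'rV[R]_k}|%:R * (d \in Omega)%:R.
Proof. by under eq_bigr do rewrite orbit_sumE; apply: fourier_inversion. Qed.

Lemma column_orbits_sub : Omega \subset column_space G.
Proof.
apply/subsetP=> d /column_orbitsP[j /unit_orbitP[u _ ->]].
exact: column_space_col.
Qed.

Lemma orbit_sum_annihilator x : x *m G = 0 -> orbit_sum x = #|Omega|%:R.
Proof.
move=> xG0; rewrite /orbit_sum -sumr_const; apply: eq_bigr => d dO.
exact: pairing_annihilator xG0 (subsetP column_orbits_sub d dO).
Qed.

Lemma column_orbitsN : [set - d | d in Omega] = Omega.
Proof.
have opp d : d \in Omega -> - d \in Omega.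
  case/column_orbitsP=> j /unit_orbitP[u Uu ->]; apply/column_orbitsP; exists j.
  by apply/unit_orbitP; exists (- u); rewrite ?unitrN // raddfN /= mulmxN.
apply/setP=> d; apply/imsetP/idP => [[e eO ->]|dO]; first exact: opp.
by exists (- d); rewrite ?opprK ?opp.
Qed.

(** Since [Omega = -Omega], one factor may be summed over [- d]; the product then runs over
    differences. *)
Lemma orbit_sum_sqr x :
  orbit_sum x ^+ 2 = \sum_d (difference_count Omega d)%:R * pairing x d.
Proof.
have orbit_sumN : orbit_sum x = \sum_(d in Omega) pairing x (- d).
  rewrite /orbit_sum -{1}column_orbitsN big_imset //= => d e _ _; exact: oppr_inj.
rewrite expr2 {2}orbit_sumN /orbit_sum big_distrlr /= pair_big /=.
rewrite (partition_big (fun p => p.1 - p.2) predT) //=; apply: eq_bigr => d _.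
rewrite mulr_natl -sumr_const; apply: eq_big => [p|p /andP[_ /eqP <-]].
  by rewrite inE andbA.
by rewrite pairingDr.
Qed.

(** * The homogeneous weight as a character sum over [Omega] *)

Hypothesis nzC : no_zero_coordinate (code_of G).

Lemma col_neq0 j : col j G != 0.
Proof.
have [_ /imsetP[x _ ->] xGj] := nzC j; apply: contraNneq xGj => Gj0.
by rewrite -mulmx_colE Gj0 mulmx0 mxE.
Qed.

Lemma column_orbits0 : 0 \notin Omega.
Proof.
apply/negP=> /column_orbitsP[j /unit_orbitP[u Uu Gu0]]; case/eqP: (col_neq0 j).
by rewrite -[LHS]mulmx1 -(mulrV Uu) -mulmx_scalarA -Gu0 mul0mx.
Qed.

(** Exactly the columns generating [dR] contribute, each with [#|units R| / #|unit_orbit d|] units.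
    Modularity cancels the orbit size, so the total is the same for every such [d]. *)
Lemma sum_unit_fibers (r : rat) d :
    d \in Omega -> (point_mult G d)%:R = r * #|unit_orbit d|%:R ->
  (\sum_j #|unit_fiber (col j G) d|)%:R = ratr r * #|units R|%:R :> K.
Proof.
move=> dO multE; have orbit_neq0 : #|unit_orbit d|%:R != 0 :> K.
  by rewrite pnatr_eq0 -lt0n; apply/card_gt0P; exists d; apply: unit_orbit_self.
have : (#|unit_orbit d| * \sum_j #|unit_fiber (col j G) d| = point_mult G d * #|units R|)%N.
  rewrite big_distrr /= -[RHS]sum_nat_const [RHS]big_mkcond; apply: eq_bigr => j _.
  rewrite inE -unit_orbit_cyclic; case: ifP => [dj|d_notin_j].
    by rewrite (unit_orbit_eq dj) card_unit_fiber.
  rewrite (_ : unit_fiber _ _ = set0) ?cards0 ?muln0 //; apply/setP=> u.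
  rewrite !inE; apply: contraFF d_notin_j => /andP[Uu /eqP <-].
  by apply/unit_orbitP; exists u.
move/(congr1 (fun m => m%:R : K)); rewrite !natrM => fiberE.
apply: (mulfI orbit_neq0); rewrite fiberE.
have := congr1 (@ratr K) multE; rewrite rmorphM !ratr_nat => ->; ring.
Qed.

(** Once the units stand on the right, the terms can be grouped by the element [d = g_j u] of
    [Omega], each hit equally often. *)
Lemma sum_chi_columns x (r : rat) :
    (forall d, d \in Omega -> (point_mult G d)%:R = r * #|unit_orbit d|%:R) ->
  \sum_j \sum_(u in units R) chi (u * (x *m G) 0 j) =
  ratr r * #|units R|%:R * orbit_sum x.
Proof.
move=> multE; rewrite /orbit_sum big_distrr /=.
transitivity (\sum_j \sum_(d in Omega) #|unit_fiber (col j G) d|%:R * pairing x d).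
  apply: eq_bigr => j _; rewrite sum_units_chiC //.
  rewrite (partition_big (fun u => col j G *m u%:M) (mem Omega)) /= => [|u]; last first.
    rewrite inE => Uu; apply/column_orbitsP; exists j.
    by apply/unit_orbitP; exists u.
  apply: eq_bigr => d _; rewrite mulr_natl -sumr_const.
  apply: eq_big => [u|u /andP[_ /eqP <-]]; first by rewrite !inE.
  by rewrite /pairing mulmxA mulmx_scalarE mulmx_colE.
rewrite exchange_big /=; apply: eq_bigr => d dO.
by rewrite -big_distrl /= -natr_sum (sum_unit_fibers dO (multE d dO)).
Qed.

Hypotheses (n_gt0 : (0 < n)%N) (modG : modular G).

Lemma hom_weight_orbit_sum :
  exists2 r : K, r != 0 &
    forall x, hom_weight_vec chi (x *m G) = r * (#|Omega|%:R - orbit_sum x).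
Proof.
have [r modr] := modG.
have units_neq0 : #|units R|%:R != 0 :> K.
  by rewrite pnatr_eq0 -lt0n; apply/card_gt0P; exists 1; rewrite inE unitr1.
have multE d : d \in Omega -> (point_mult G d)%:R = r * #|unit_orbit d|%:R.
  move=> dO; have [|mult0|//] := modr d.
    by apply: contraNneq column_orbits0 => <-.
  have /column_orbitsP[j dj] := dO.
  have : j \in [set j | cyclic_submodule (col j G) == cyclic_submodule d].
    by rewrite inE -unit_orbit_cyclic.
  by rewrite (cards0_eq mult0) inE.
have weightE x : hom_weight_vec chi (x *m G) = n%:R - ratr r * orbit_sum x.
  rewrite /hom_weight_vec /hom_weight sumrB sumr_const card_ord -big_distrr /=.
  rewrite (sum_chi_columns x multE); congr (_ - _).
  by rewrite mulrC mulrAC mulfK.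
(* At [x = 0] the weight vanishes and the orbit sum is [#|Omega|], which fixes the constant; as [n]
   is positive, it also gives [r != 0]. *)
have nE : n%:R = ratr r * #|Omega|%:R :> K.
  have := weightE 0; rewrite orbit_sum_annihilator ?mul0mx //.
  rewrite /hom_weight_vec big1 => [/eqP|j _]; first by rewrite eq_sym subr_eq0 => /eqP.
  rewrite /hom_weight mxE (eq_bigr (fun=> 1)) => [|u _]; last by rewrite mulr0 chi0.
  by rewrite sumr_const mulVf ?subrr.
exists (ratr r) => [|x]; last by rewrite weightE nE mulrBr.
by apply: contraTneq n_gt0 => r0; rewrite -eqn0Ngt -(pnatr_eq0 K) nE r0 mul0r eqxx.
Qed.

(** The columns of [G] lie in [Omega] and generate [D], so a submodule containing [Omega] contains
    [D]. *)
Lemma right_submodule_orbits :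
  right_submodule (0 |: Omega) <-> 0 |: Omega = column_space G.
Proof.
split=> [[O0 addO mulO]|->]; last first.
  have D0 : 0 \in column_space G by apply/column_spaceP; exists 0; rewrite mulmx0.
  split=> // [d e Dd De|a _ /column_spaceP[y ->]].
    by rewrite -[e]opprK column_spaceB // -sub0r column_spaceB.
  by apply/column_spaceP; exists (y *m a%:M); rewrite mulmxA.
apply/eqP; rewrite eqEsubset subUset sub1set column_orbits_sub andbT; apply/andP; split.
  by apply/column_spaceP; exists 0; rewrite mulmx0.
apply/subsetP=> _ /column_spaceP[y ->].
have -> : G *m y = \sum_j col j G *m (y j 0)%:M.
  apply/matrixP=> i j; rewrite ord1 summxE mxE; apply: eq_bigr => l _.
  by rewrite mulmx_scalarE mxE.
elim/big_ind: _ => // j _; apply: mulO; rewrite in_setU1; apply/orP; right.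
by apply/column_orbitsP; exists j; apply: unit_orbit_self.
Qed.

Lemma column_orbits_col j : col j G \in Omega.
Proof. by apply/column_orbitsP; exists j; apply: unit_orbit_self. Qed.

(** * Weights and the values of the orbit sum *)

Local Notation annihilator := [set x : 'rV[R]_k | x *m G == 0].

Definition two_orbit_sums : Prop :=
  exists x1 x2, [/\ x1 *m G != 0, x2 *m G != 0, orbit_sum x1 != orbit_sum x2 &
    forall x, x *m G != 0 -> orbit_sum x = orbit_sum x1 \/ orbit_sum x = orbit_sum x2].

(** The weight is an injective affine function of the orbit sum, and by the condition on [C_0]
    nonzero weight means nonzero codeword. *)
Lemma two_weight_orbit_sums :
    [set c in code_of G | hom_weight_vec chi c == 0] = [set 0] ->
  two_weight_code chi (code_of G) <-> two_orbit_sums.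
Proof.
move=> C0; have [r r_neq0 weightE] := hom_weight_orbit_sum.
have inC x : x *m G \in code_of G by apply/imsetP; exists x.
have weight_eq0 x : (hom_weight_vec chi (x *m G) == 0) = (x *m G == 0).
  by move/setP/(_ (x *m G)): C0; rewrite !inE inC.
have weight_inj x y : orbit_sum x = orbit_sum y <->
    hom_weight_vec chi (x *m G) = hom_weight_vec chi (y *m G).
  by rewrite !weightE; split=> [->//|/(mulfI r_neq0)/addrI/oppr_inj].
split=> [[w1 [w2 [w1_neq0 w2_neq0 w12 wP]]]|[x1 [x2 [x1G x2G x12 xP]]]].
  have [_ /imsetP[x1 _ ->] x1w] := proj2 (wP w1 w1_neq0) (or_introl erefl).
  have [_ /imsetP[x2 _ ->] x2w] := proj2 (wP w2 w2_neq0) (or_intror erefl).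
  exists x1, x2; split; rewrite -?weight_eq0 ?x1w ?x2w //.
    by apply: contra_neq w12 => /weight_inj; rewrite x1w x2w.
  move=> x; rewrite -weight_eq0 => /wP[+ _].
  by case=> [|xw|xw]; [by exists (x *m G)|left|right]; apply/weight_inj;
    rewrite ?x1w ?x2w.
exists (hom_weight_vec chi (x1 *m G)), (hom_weight_vec chi (x2 *m G)).
split; rewrite ?weight_eq0 //; first by apply: contra_neq x12 => /weight_inj.
move=> w w_neq0; split=> [[_ /imsetP[x _ ->] xw]|[->|->]];
  [|by exists (x1 *m G)|by exists (x2 *m G)].
have xG : x *m G != 0 by rewrite -weight_eq0 xw.
by rewrite -xw; case: (xP x xG) => /weight_inj; [left|right].
Qed.

(** The sum over all of [D] vanishes, and the element 0 contributes 1 to it. *)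
Lemma orbit_sum_full x :
  0 |: Omega = column_space G -> x *m G != 0 -> orbit_sum x = -1.
Proof.
move=> OmegaD /sum_pairing_column_space; rewrite -OmegaD big_setU1 ?column_orbits0 //=.
by rewrite pairing0r addrC => /eqP; rewrite addr_eq0 => /eqP.
Qed.

Lemma sum_pairing_annihilator d :
  d \in column_space G ->
  \sum_(x in annihilator) pairing x (- d) = #|annihilator|%:R.
Proof.
move=> Dd; rewrite -sumr_const; apply: eq_bigr => x; rewrite inE => /eqP xG0.
apply: pairing_annihilator => //.
by rewrite -sub0r column_spaceB //; apply/column_spaceP; exists 0; rewrite mulmx0.
Qed.

(* By Fourier inversion the indicator function of Omega is constant on D minus 0. *)
Lemma constant_orbit_sum s :
  (forall x, x *m G != 0 -> orbit_sum x = s) -> 0 |: Omega = column_space G.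
Proof.
move=> sumE.
have transformE d : d \in column_space G -> d != 0 ->
    #|{: 'rV[R]_k}|%:R * (d \in Omega)%:R
    = (#|Omega|%:R - s) * #|annihilator|%:R :> K.
  move=> Dd d_neq0; rewrite -fourier_orbit_sum -(sum_pairing_annihilator Dd).
  rewrite -sum_indicator big_distrr /=.
  apply/eqP; rewrite -subr_eq0 -sumrB; apply/eqP.
  (* Subtracting the excess [#|Omega| - s] on the annihilator leaves the constant transform [s],
     whose inverse transform is supported at 0. *)
  transitivity (\sum_x s * pairing x (- d)).
    apply: eq_bigr => x _; rewrite inE; case: eqP => [xG0|/eqP/sumE ->] /=; last by ring.
    rewrite orbit_sum_annihilator //; ring.
  by rewrite -big_distrr /= sum_pairing_row oppr_eq0 (negPf d_neq0) !mulr0.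
apply/eqP; rewrite eqEsubset subUset sub1set column_orbits_sub andbT; apply/andP; split.
  by apply/column_spaceP; exists 0; rewrite mulmx0.
apply/subsetP=> d Dd; rewrite in_setU1; have [//|d_neq0] := eqVneq d 0.
(* The column [g] is a nonzero element of [Omega], so the constant value of the indicator is 1. *)
pose g := col (Ordinal n_gt0) G; have gO : g \in Omega := column_orbits_col _.
have := transformE g (subsetP column_orbits_sub _ gO) (col_neq0 _).
rewrite -(transformE d Dd d_neq0) gO => /(mulfI card_rows_neq0)/eqP.
by rewrite eqr_nat; case: (d \in Omega).
Qed.

(** * Difference counts and the quadratic equation for orbit sums *)

Lemma difference_count0 : difference_count Omega 0 = #|Omega|.
Proof.
have inj_diag : injective (fun d : 'cV[R]_k => (d, d)) by move=> d e [].
rewrite -(card_imset _ inj_diag); apply: eq_card => -[d e]; rewrite inE /= subr_eq0.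
apply/and3P/imsetP => [[dO _ /eqP <-]|[f fO [-> ->]]]; first by exists d.
by split.
Qed.

Lemma difference_count_out d : d \notin column_space G -> difference_count Omega d = 0%N.
Proof.
move=> d_notin; apply/eqP; rewrite cards_eq0; apply/eqP/setP=> -[e f].
rewrite !inE /=; apply: contraNF d_notin => /and3P[eO fO /eqP <-].
by rewrite column_spaceB // (subsetP column_orbits_sub).
Qed.

(** Off the annihilator [(S - s1) (S - s2) = 0]. Inverting this relation expresses the difference
    count on nonzero elements of [D] through the indicator of [Omega]. *)
Lemma two_orbit_sums_pds :
  two_orbit_sums -> partial_difference_set (column_space G) Omega.
Proof.
case=> x1 [x2 [_ _ _]]; set s1 := orbit_sum x1; set s2 := orbit_sum x2 => sumP.
(* The rows of the annihilator have orbit sum [#|Omega|] and pair trivially with [D]; [c] is their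
   contribution to the inverse transform of [(S - s1) (S - s2)]. *)
pose c : K := (#|Omega|%:R - s1) * (#|Omega|%:R - s2) * #|annihilator|%:R.
have countE d : d \in column_space G -> d != 0 ->
    #|{: 'rV[R]_k}|%:R * (difference_count Omega d)%:R
    = #|{: 'rV[R]_k}|%:R * (d \in Omega)%:R * (s1 + s2) + c.
  move=> Dd d_neq0; rewrite -fourier_orbit_sum /c -(sum_pairing_annihilator Dd).
  rewrite -(fourier_inversion (fun d => (difference_count Omega d)%:R)).
  rewrite -sum_indicator big_distrr big_distrl /= -big_split /=.
  apply/eqP; rewrite -subr_eq0 -sumrB; apply/eqP.
  transitivity (\sum_x - (s1 * s2) * pairing x (- d)).
    apply: eq_bigr => x _; rewrite -orbit_sum_sqr inE; case: eqP => [xG0|/eqP/sumP] /=.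
      rewrite orbit_sum_annihilator //; ring.
    by case=> ->; ring.
  by rewrite -big_distrr /= sum_pairing_row oppr_eq0 (negPf d_neq0) !mulr0.
have count_eq d e : d \in column_space G -> d != 0 -> e \in column_space G -> e != 0 ->
    (d \in Omega) = (e \in Omega) -> (difference_count Omega d)%:Z = difference_count Omega e.
  move=> Dd d_neq0 De e_neq0 deO; congr Posz; apply/eqP; rewrite -(eqr_nat K); apply/eqP.
  by apply: (mulfI card_rows_neq0); rewrite !countE // deO.
have neq0 d : d \in Omega -> d != 0.
  by move=> dO; apply: contraNneq column_orbits0 => <-.
have OmegaD := subsetP column_orbits_sub.
split; [exact: column_orbits_sub|exact: column_orbits0|exact: column_orbitsN|].
pose g := col (Ordinal n_gt0) G; have gO : g \in Omega := column_orbits_col _.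
exists (difference_count Omega g).
have [D0|[e]] := set_0Vmem (column_space G :\: (0 |: Omega)).
  (* Here [Omega] and 0 fill [D], so no element determines [mu] and 0 is an arbitrary choice. *)
  exists 0; split=> [d dO|d]; last by rewrite D0 inE.
  by apply: count_eq; rewrite ?neq0 ?OmegaD ?dO ?gO.
rewrite !inE negb_or => /andP[/andP[e_neq0 eO] De].
exists (difference_count Omega e); split=> d; last first.
  rewrite !inE negb_or => /andP[/andP[d_neq0 dO] Dd].
  by apply: count_eq; rewrite ?(negPf dO) ?(negPf eO).
by move=> dO; apply: count_eq; rewrite ?neq0 ?OmegaD ?dO ?gO.
Qed.

Lemma pds_orbit_sum_sqr :
    partial_difference_set (column_space G) Omega ->
  exists a b : K, forall x, x *m G != 0 -> orbit_sum x ^+ 2 = a * orbit_sum x + b.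
Proof.
case=> _ _ _ [lambda [mu [lambdaP muP]]].
(* Relative to [mu] times the indicator of [D], whose transform vanishes at [x], the difference
   count has excess [lambda - mu] on [Omega] and [#|Omega| - mu] at 0. *)
exists (lambda%:~R - mu%:~R), (#|Omega|%:R - mu%:~R) => x xG.
have countE d : (difference_count Omega d)%:R = (#|Omega|%:R - mu%:~R) * (d \in [set 0])%:R
    + (lambda%:~R - mu%:~R) * (d \in Omega)%:R + mu%:~R * (d \in column_space G)%:R :> K.
  rewrite inE; have [->|d_neq0] := eqVneq d 0.
    rewrite difference_count0 (negPf column_orbits0).
    have -> : 0 \in column_space G by apply/column_spaceP; exists 0; rewrite mulmx0.
    by rewrite /=; ring.
  have [dO|dO] := boolP (d \in Omega).
    rewrite (subsetP column_orbits_sub) // -(lambdaP d dO) -pmulrn /=; ring.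
  have [Dd|Dd] := boolP (d \in column_space G); last first.
    by rewrite difference_count_out //=; ring.
  rewrite -(muP d) ?inE ?negb_or ?d_neq0 ?dO // -pmulrn /=; ring.
rewrite orbit_sum_sqr; under eq_bigr do rewrite countE !mulrDl -!mulrA.
rewrite !big_split /= -!big_distrr /= !sum_indicator big_set1 pairing0r.
by rewrite (sum_pairing_column_space xG) /orbit_sum; ring.
Qed.

(** A quadratic equation allows at most two values, and a single value would force [Omega] and 0 to
    fill [D]. *)
Lemma pds_two_orbit_sums :
    partial_difference_set (column_space G) Omega ->
    0 |: Omega <> column_space G ->
  two_orbit_sums.
Proof.
move=> /pds_orbit_sum_sqr[a [b sqrE]] not_full.
have [_ /imsetP[x1 _ ->] x1Gj] := nzC (Ordinal n_gt0).
have x1G : x1 *m G != 0 by apply: contraNneq x1Gj => ->; rewrite mxE.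
case: (boolP [exists x, (x *m G != 0) && (orbit_sum x != orbit_sum x1)]); last first.
  move/existsPn=> const; case: not_full;
  apply: (@constant_orbit_sum (orbit_sum x1)) => x xG.
  by apply/eqP; have := const x; rewrite xG => /negPn.
case/existsP=> x2 /andP[x2G x21]; exists x1, x2; split=> //; first by rewrite eq_sym.
(* Subtracting the quadratic equations of two distinct roots and cancelling their difference gives
   the sum of the roots, hence the factorization. *)
move=> x xG; have vieta : orbit_sum x1 + orbit_sum x2 = a.
  apply: (mulIf (x := orbit_sum x2 - orbit_sum x1)); first by rewrite subr_eq0.
  transitivity (orbit_sum x2 ^+ 2 - orbit_sum x1 ^+ 2); first by ring.
  by rewrite !sqrE //; ring.
have : (orbit_sum x - orbit_sum x1) * (orbit_sum x - orbit_sum x2) == 0.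
  have -> : orbit_sum x2 = a - orbit_sum x1 by rewrite -vieta addrC addKr.
  apply/eqP; transitivity (orbit_sum x ^+ 2 - a * orbit_sum x
    - (orbit_sum x1 ^+ 2 - a * orbit_sum x1)); first by ring.
  by rewrite !sqrE //; ring.
by rewrite mulf_eq0 !subr_eq0 => /orP[]/eqP; [left|right].
Qed.

End Fourier.

Theorem theorem17 (K : numClosedFieldType) (R : finUnitRingType)
    (chi : R -> K) (frobR : generating_character chi)
    (k n : nat) (k_gt0 : (0 < k)%N) (n_gt0 : (0 < n)%N) (G : 'M[R]_(k, n))
    (nzC : no_zero_coordinate (code_of G)) (modG : modular G)
    (C0 : [set c in code_of G | hom_weight_vec chi c == 0] = [set 0]) :
  two_weight_code chi (code_of G) <->
  partial_difference_set (column_space G) (column_orbits G) /\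
  ~ right_submodule (0 |: column_orbits G).
Proof.
rewrite two_weight_orbit_sums // right_submodule_orbits; split=> [sums|[pds not_full]].
  split; first exact: two_orbit_sums_pds sums.
  (* If [Omega] and 0 filled [D], both orbit sums would be -1. *)
  move=> full; have [x1 [x2 [x1G x2G]]] := sums.
  by rewrite !orbit_sum_full // eqxx.
exact: pds_two_orbit_sums pds not_full.
Qed.
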